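(* Let $\mathcal G<\mathcal G'$ be grids with multivalued maps on them and a grid map morphism $\mathcal G\to\mathcal G'$; let $\mathcal S\subset\mathcal G$ be a Morse set, $\mathcal S'\subset\mathcal G'$ the corresponding Morse set (the one containing the image of $\mathcal S$), $h:\mathcal S\to\mathcal S'$ the restriction of the morphism, $\mathcal F:\mathcal S\rightrightarrows\mathcal S$ and $\mathcal F':\mathcal S'\rightrightarrows\mathcal S'$ the induced restriction maps, and $\bar{\mathcal F}:=h\circ\mathcal F\circ h^{-1}:\mathcal S'\rightrightarrows\mathcal S'$. Let $h:\mathcal S\to\mathcal S'$ be surjective. (1) Let $\mathcal F$ be $d$-periodic ($d>1$) and let $h(G)=h(H)$ for some $G\in\mathcal S_i$ and $H\in\mathcal S_j$, where $\mathcal S_i$ and $\mathcal S_j$ are elements of the $d$-periodic partition of $\mathcal S$ and $i-j$ is relatively prime to $d$. Then $\bar{\mathcal F}$ is mixing. (2) Let $\bar{\mathcal F}$ be $d$-periodic ($d>1$) and let $\mathcal F'$ add an edge from $G'$ to $H'$ (that is, $H'\in\mathcal F'(G')$ but $H'\notin\bar{\mathcal F}(G')$) for some $G'\in\mathcal S'_i$ and $H'\in\mathcal S'_j$, where $\mathcal S'_i$ and $\mathcal S'_j$ are elements of the $d$-periodic partition of $\mathcal S'$ (for $\bar{\mathcal F}$) and $i-j+1$ is relatively prime to $d$. Then $\mathcal F'$ is mixing.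
   Context: A grid $\mathcal G$ on a compact metric space $X$ is a finite collection of nonempty compact subsets of $X$ such that (1) $X=\bigcup_{G\in\mathcal G}G$; (2) $G=\operatorname{cl}(\operatorname{int}(G))$ for all $G$; (3) $G\cap\operatorname{int}(H)=\emptyset$ for all $G\ne H$ in $\mathcal G$. $\mathcal G<\mathcal G'$ means that every $G\in\mathcal G$ is contained in some $G'\in\mathcal G'$. A multivalued map $\mathcal F:\mathcal G\rightrightarrows\mathcal G$ assigns to each $G$ a subset $\mathcal F(G)\subset\mathcal G$, and is identified with the directed graph on $\mathcal G$ with an edge $G\to H$ whenever $H\in\mathcal F(G)$; orbits are paths in this graph. A map $h$ is a grid map morphism from $\mathcal F$ to $\mathcal F'$ if $h(\mathcal F(G))\subset\mathcal F'(h(G))$ for all $G$. The Morse sets of a multivalued map are the nontrivial strongly connected components of its graph (a single vertex with a loop counts as nontrivial). The induced restriction map of $\mathcal F$ on a Morse set $\mathcal S$ is $G\mapsto\mathcal F(G)\cap\mathcal S$. A grid map morphism sends each Morse set into a single Morse set. $\bar{\mathcal F}$ has an edge $G'\to H'$ iff $\mathcal F$ has an edge $G\to H$ for some $G,H\in\mathcal S$ with $h(G)=G'$, $h(H)=H'$; thus $\bar{\mathcal F}(G')\subset\mathcal F'(G')$ for all $G'\in\mathcal S'$. A multivalued map $\mathcal F$ on a finite set $\mathcal S$ is transitive if for any $G,H\in\mathcal S$ there is $n>0$ with $H\in\mathcal F^n(G)$, and mixing if there is $n>0$ such that $H\in\mathcal F^m(G)$ for all $G,H\in\mathcal S$ and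 all $m\ge n$. The maps $\mathcal F,\bar{\mathcal F},\mathcal F'$ here are transitive. If $\mathcal F$ is transitive, $\mathcal S$ can be partitioned into subsets $\mathcal S_1,\dots,\mathcal S_d$ for some $d$, cyclically permuted by $\mathcal F$ ($\mathcal F(\mathcal S_i)=\mathcal S_{i+1\bmod d}$) and such that $\mathcal F^d|_{\mathcal S_i}:\mathcal S_i\rightrightarrows\mathcal S_i$ is mixing for each $i$; the minimal such $d$ is the period $\operatorname{per}(\mathcal F)$ (equivalently, the greatest common divisor of the lengths of closed orbits), $\mathcal F$ is called $d$-periodic, and the partition is the $d$-periodic partition. A mixing map is 1-periodic. *)

(* Defs.v *)
From HB Require Import structures.
From mathcomp Require Import all_boot all_order all_algebra finmap.
From mathcomp Require Import boolp classical_sets reals topology.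

Set Implicit Arguments.
Unset Strict Implicit.
Unset Printing Implicit Defensive.

(* A multivalued map on a finite set S is a function F : T -> {set T} on an
   ambient finType T together with a subset S : {set T}; the values of F
   outside S play no role in the notions below that take both. *)
Section MultivaluedMaps.
Variable T : finType.
Implicit Types (F : T -> {set T}) (S A : {set T}).

Definition mv_image F A : {set T} := (\bigcup_(x in A) F x)%SET.

Definition mv_iter F (n : nat) (x : T) : {set T} :=
  iter n (mv_image F) [set x]%SET.

Definition mv_restr F S : T -> {set T} := fun x => (F x :&: S)%SET.

Definition mv_edge F : rel T := fun x y => y \in F x.

Definition strong_component F S : Prop :=
  exists x, S = [set y | connect (mv_edge F) x y && connect (mv_edge F) y x]%SET.

Definition morse_set F S : Prop :=
  strong_component F S /\
  (1 < #|S| \/ exists2 x, x \in S & x \in F x).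

Definition mv_transitive F S : Prop :=
  {in S &, forall x y, exists2 n, 0 < n & y \in mv_iter F n x}.

Definition mv_mixing F S : Prop :=
  exists2 n, 0 < n &
    forall m, n <= m -> {in S &, forall x y, y \in mv_iter F m x}.

(* The classes are numbered 0, ..., d-1, and [ordS i] is i+1 modulo d. *)
Definition cyclic_partition F S (d : nat) (P : 'I_d -> {set T}) : Prop :=
  [/\ injective P,
      finset.partition [set P i | i in 'I_d]%SET S,
      forall i, mv_image F (P i) = P (ordS i) &
      forall i, mv_mixing (mv_restr (mv_iter F d) (P i)) (P i)].

Definition mv_periodic F S (d : nat) : Prop :=
  [/\ mv_transitive F S, 0 < d,
      exists P : 'I_d -> {set T}, cyclic_partition F S P &
      forall e, 0 < e ->
        (exists P : 'I_e -> {set T}, cyclic_partition F S P) -> d <= e].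

Definition periodic_partition F S (d : nat) (P : 'I_d -> {set T}) : Prop :=
  mv_periodic F S d /\ cyclic_partition F S P.

End MultivaluedMaps.

Section Morphisms.
Variables T T' : finType.

Definition grid_morphism (F : T -> {set T}) (F' : T' -> {set T'})
    (h : T -> T') : Prop :=
  forall x, (h @: F x \subset F' (h x))%SET.

(* h o F o h^-1, for F on S and h restricted to S *)
Definition mv_push (F : T -> {set T}) (S : {set T}) (h : T -> T') :
    T' -> {set T'} :=
  fun x' => (h @: mv_image F [set x in S | h x == x'])%SET.

End Morphisms.

Section Grids.
Local Open Scope classical_set_scope.
Variables (R : realType) (X : metricType R).
Implicit Types G : {fset (set X)}.

Definition is_grid G : Prop :=
  [/\ forall A, A \in G -> A !=set0 /\ compact A,
      [set: X] = \bigcup_(A in [set` G]) A,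
      forall A, A \in G -> A = closure A° &
      forall A B, A \in G -> B \in G -> A <> B -> A `&` B° = set0].

Definition grid_lt G G' : Prop :=
  forall A, A \in G -> exists2 A', A' \in G' & A `<=` A'.

End Grids.

(* Main.v *)
(* The lengths of the closed orbits through a point form an additive set, which
   contains all large multiples of d. Identifying a point of P i with one of
   P j, or adding an edge from P i to P j, puts into it a number congruent
   modulo d to i - j, resp. i - j + 1. As this number is prime to d, the set is
   cofinite, and a transitive map with such a point is mixing. *)
Require Import Defs.
From mathcomp Require Import all_boot all_order all_algebra finmap.
From mathcomp Require Import boolp classical_sets reals topology.

Set Implicit Arguments.
Unset Strict Implicit.
Unset Printing Implicit Defensive.

Import GRing.Theory.

(** Since [l] is invertible modulo [d], the multiples [c * l] with [c < d] meet every residue class;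
    adding a large multiple of [d] then reaches every large [n]. *)
Lemma add_closed_cofinite (L : nat -> Prop) (d l M : nat) :
    (forall a b, L a -> L b -> L (a + b)) ->
    0 < d -> 0 < l -> coprime l d ->
    (forall m, M <= m -> L (m * d)) -> L l ->
  exists N, forall n, N <= n -> L n.
Proof.
move=> LD d0 l0 /(coprimeP _ l0)[[u v] /= uv] Ld Ll.
(* [L 0] is not assumed, so the base [M * d] makes [c = 0] admissible. *)
have Lc c : L (M * d + c * l).
  elim: c => [|c IHc]; first by rewrite addn0; apply: Ld.
  by rewrite mulSnr addnA; apply: LD.
(* One [M * d] is the base in [Lc], [d * l] bounds [c * l], and the other [M * d] leaves a remainder
   that is at least [M] times [d]. *)
exists (M * d + (M * d + d * l)) => n leNn.
(* By Bezout [u] inverts [l] modulo [d], so this [c] gives [c * l] the residue of [n]. *)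
pose c := (n * u) %% d.
have lt_cd : c < d by rewrite ltn_mod.
have ul : u * l = 1 + v * d.
  by rewrite -uv subnK // ltnW // -subn_gt0 uv.
have cl : c * l = n %[mod d].
  by rewrite modnMml -mulnA ul mulnDr muln1 mulnA addnC modnMDl.
have le_cl : c * l <= d * l by rewrite leq_mul2r ltnW ?orbT.
have le1 : M * d + c * l <= n.
  apply: leq_trans leNn; rewrite leq_add2l.
  by apply: leq_trans le_cl _; rewrite leq_addl.
have : d %| n - (M * d + c * l).
  by rewrite -eqn_mod_dvd // modnMDl cl.
case/dvdnP=> q eq_q.
rewrite -(subnKC le1) eq_q; apply: LD => //; apply: Ld.
rewrite -(leq_pmul2r d0) -eq_q leq_subRL //.
by apply: leq_trans leNn; rewrite -addnA leq_add2l addnC leq_add2l.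
Qed.

Section Orbits.
Variable T : finType.
Implicit Types (F : T -> {set T}) (S A : {set T}).

Lemma mem_iter_image F n A y :
  reflect (exists2 x, x \in A & y \in mv_iter F n x)
          (y \in iter n (mv_image F) A).
Proof.
apply: (iffP idP).
  elim: n y => [|n IHn] y /=.
    by move=> Ay; exists y; rewrite // /mv_iter /= inE.
  case/bigcupP=> z /IHn[x Ax zx] yz; exists x => //.
  by apply/bigcupP; exists z.
case=> x Ax; elim: n y => [|n IHn] y /=; first by rewrite inE => /eqP->.
by case/bigcupP=> z /IHn zA yz; apply/bigcupP; exists z.
Qed.

Lemma mv_iterD F m n x y z :
  y \in mv_iter F m x -> z \in mv_iter F n y -> z \in mv_iter F (m + n) x.
Proof.
move=> yx zy; rewrite /mv_iter addnC iterD.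
by apply/mem_iter_image; exists y.
Qed.

Lemma mv_iter1 F x y : y \in F x -> y \in mv_iter F 1 x.
Proof. by move=> yx; apply/bigcupP; exists x; rewrite ?inE. Qed.

Lemma mv_iterS F n x y :
  y \in mv_iter F n.+1 x -> exists2 z, z \in mv_iter F n x & y \in F z.
Proof. by case/bigcupP=> z zx yz; exists z. Qed.

Lemma mv_iter_sub F S n x y :
    {in S, forall x, F x \subset S} ->
  x \in S -> y \in mv_iter F n x -> y \in S.
Proof.
move=> FS xS; elim: n y => [|n IHn] y; first by rewrite inE => /eqP->.
by case/mv_iterS=> z /IHn zS; apply: (fintype.subsetP (FS z zS)).
Qed.

(** A path from [y] to [z] can be led through [x], where closed orbits of every large length take up
    the difference to the prescribed length. *)
Lemma mv_mixing_coprime F S d l M x :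
    mv_transitive F S -> x \in S -> 0 < d -> 0 < l -> coprime l d ->
    (forall m, M <= m -> x \in mv_iter F (m * d) x) -> x \in mv_iter F l x ->
  mv_mixing F S.
Proof.
move=> trF xS d0 l0 co_ld loopd loopl.
pose L n : Prop := x \in mv_iter F n x.
have [|N loopN] := @add_closed_cofinite L _ _ _ _ d0 l0 co_ld loopd loopl.
  by move=> a b; apply: mv_iterD.
(* One connecting length is chosen for each pair of points of [S], with default 0 for other pairs,
   so that finiteness bounds them all. *)
have [|len lenP] := @fin_all_exists (T * T)%type (fun=> nat)
    (fun p n => p.1 \in S -> p.2 \in S -> p.2 \in mv_iter F n p.1).
  move=> [y z] /=; case: (boolP ((y \in S) && (z \in S))) => [/andP[yS zS]|].
    by have [n _ nP] := trF y z yS zS; exists n.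
  by move=> nyz; exists 0 => yS zS; rewrite yS zS in nyz.
pose m0 := \max_p len p.
have le_len p : len p <= m0 by apply: leq_bigmax.
(* Room for two connecting paths and a closed orbit of length at least [N]; the successor makes the
   bound positive. *)
exists (m0 + (m0 + N)).+1 => // m le_m y z yS zS.
have le_mid : len (y, x) + (len (x, z) + N) <= m.
  by apply: leq_trans (ltnW le_m); rewrite !leq_add.
have -> : m = len (y, x) + ((m - (len (y, x) + len (x, z))) + len (x, z)).
  by rewrite addnCA subnK // (leq_trans _ le_mid) // leq_add2l leq_addr.
apply: mv_iterD (lenP (y, x) yS xS) _.
apply: mv_iterD (lenP (x, z) xS zS); apply: loopN.
by rewrite leq_subRL -?addnA // (leq_trans _ le_mid) // leq_add2l leq_addr.
Qed.

End Orbits.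

(** A path is mapped edge by edge; as [F] does not leave [S], the morphism condition applies at each
    of its vertices. *)
Lemma mv_iter_morph (T T' : finType) (F : T -> {set T}) (F' : T' -> {set T'})
    (S : {set T}) (h : T -> T') n x y :
    {in S, forall x, F x \subset S} ->
    {in S, forall x, h @: F x \subset F' (h x)} ->
  x \in S -> y \in mv_iter F n x -> h y \in mv_iter F' n (h x).
Proof.
move=> FS hF xS; elim: n y => [|n IHn] y; first by rewrite !inE => /eqP->.
case/mv_iterS=> z zx yz; apply/bigcupP; exists (h z); first exact: IHn.
by apply: (fintype.subsetP (hF z (mv_iter_sub FS xS zx))); apply: imset_f.
Qed.

Lemma mv_iter_mono (T : finType) (F F' : T -> {set T}) n x y :
    (forall x, F x \subset F' x) ->
  y \in mv_iter F n x -> y \in mv_iter F' n x.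
Proof.
move=> FF'; apply: (@mv_iter_morph _ _ F F' finset.setT id).
- by move=> z _; apply: finset.subsetT.
- by move=> z _; rewrite imset_id.
- by rewrite inE.
Qed.

Lemma mv_iter_iter (T : finType) (F : T -> {set T}) d m x y :
  y \in mv_iter (mv_iter F d) m x -> y \in mv_iter F (m * d) x.
Proof.
elim: m y => [|m IHm] y //; case/mv_iterS=> z /IHm zx yz.
by rewrite mulSnr; apply: mv_iterD yz.
Qed.

Section CyclicPartition.
Variables (T : finType) (F : T -> {set T}) (S : {set T}).
Variables (d : nat) (P : 'I_d -> {set T}).
Hypothesis cycP : cyclic_partition F S P.

Lemma cyclic_partition_sub i x : x \in P i -> x \in S.
Proof.
case: cycP => _ /and3P[/eqP <- _ _] _ _ xP.
by apply/bigcupP; exists (P i) => //; apply: imset_f.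
Qed.

(** A path of the [d]-th iterate inside [P i], supplied by mixing, unfolds to a path of [F] that is
    [d] times as long. *)
Lemma cyclic_partition_return i :
  exists M, forall m, M <= m ->
    {in P i &, forall x y, y \in mv_iter F (m * d) x}.
Proof.
case: cycP => _ _ _ /(_ i)[M _ mixM]; exists M => m leMm x y xP yP.
apply: mv_iter_iter; apply: mv_iter_mono (mixM m leMm x y xP yP) => z.
exact: subsetIl.
Qed.

Lemma cyclic_partition_iter n (i j : 'I_d) :
  (i + n) %% d = j -> iter n (mv_image F) (P i) = P j.
Proof.
case: cycP => _ _ FP _; elim: n j => [|n IHn] j.
  by rewrite addn0 modn_small // => eq_ij; congr P; apply: val_inj.
have d0 : 0 < d by apply: leq_ltn_trans (ltn_ord j).
have lt_d : (i + n) %% d < d by rewrite ltn_mod.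
move=> eq_j; rewrite iterS (IHn (Ordinal lt_d)) // FP; congr P.
by apply: val_inj; rewrite /= -eq_j addnS -addn1 modnDml addn1.
Qed.

(* The summand d keeps the subtraction from being truncated. *)
Lemma cyclic_partition_path i j x y :
    x \in P i -> y \in P j ->
  exists M, forall m, M <= m -> y \in mv_iter F (m * d + (j + d - i)) x.
Proof.
move=> xP yP; have [M retM] := cyclic_partition_return i.
exists M => m leMm.
have le_i : i <= j + d by rewrite (leq_trans (ltnW (ltn_ord i))) ?leq_addl.
have eq_j : (i + (j + d - i)) %% d = j by rewrite subnKC // modnDr modn_small.
(* [y] is reached in [j + d - i] steps from some [z] in [P i], and [z] is reached from [x] in
   [m * d] steps. *)
move: yP; rewrite -(cyclic_partition_iter eq_j) => /mem_iter_image[z zP yz].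
exact: mv_iterD (retM m leMm x z xP zP) yz.
Qed.

End CyclicPartition.

(** The two numbers differ by [d], which does not change the gcd with [d]. The cases [e = 0] and
    [e = 1] serve the two halves of the theorem. *)
Lemma coprimez_ord_sub d (i j : 'I_d) e :
  coprimez (i%:Z - j%:Z + e%:Z)%R d%:Z = coprime (i + d - j + e) d.
Proof.
have le_j : j <= i + d by rewrite (leq_trans (ltnW (ltn_ord j))) ?leq_addl.
rewrite -[RHS]/(coprimez (i + d - j + e)%N%:Z d%:Z) PoszD -subzn // PoszD.
rewrite [coprimez _ _]coprimez_sym [RHS]coprimez_sym /coprimez.
have -> : (i%:Z + d%:Z - j%:Z + e%:Z = 1 * d%:Z + (i%:Z - j%:Z + e%:Z))%R.
  by rewrite mul1r !addrA [(d%:Z + _)%R]addrC.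
by rewrite gcdzMDl.
Qed.

Theorem theorem6p3 (R : realType) (X : metricType R)
    (Xcompact : compact [set: X]%classic)
    (G G' : {fset (set X)}) (gridG : is_grid G) (gridG' : is_grid G')
    (ltGG' : grid_lt G G')
    (F0 : G -> {set G}) (F0' : G' -> {set G'})
    (h : G -> G') (hmorph : grid_morphism F0 F0' h)
    (S : {set G}) (S' : {set G'})
    (morseS : morse_set F0 S) (morseS' : morse_set F0' S')
    (hS : (h @: S \subset S')%SET)
    (hsurj : forall y, y \in S' -> exists2 x, x \in S & h x = y) :
  let F := mv_restr F0 S in
  let F' := mv_restr F0' S' in
  let Fbar := mv_push F S h in
  (forall (d : nat) (P : 'I_d -> {set G}) (i j : 'I_d) (A B : G),
     1 < d -> periodic_partition F S P ->
     A \in P i -> B \in P j -> h A = h B ->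
     coprimez (i%:Z - j%:Z)%R d%:Z ->
     mv_mixing Fbar S')
  /\
  (forall (d : nat) (P : 'I_d -> {set G'}) (i j : 'I_d) (A B : G'),
     1 < d -> periodic_partition Fbar S' P ->
     A \in P i -> B \in P j -> B \in F' A -> B \notin Fbar A ->
     coprimez (i%:Z - j%:Z + 1)%R d%:Z ->
     mv_mixing F' S').
Proof.
move=> F F' Fbar.
have FS : {in S, forall x, F x \subset S} by move=> x _; apply: subsetIr.
have hF : {in S, forall x, h @: F x \subset Fbar (h x)}.
  by move=> x xS; apply/imsetS/(finset.bigcup_sup x); rewrite inE xS /=.
(* An edge of [Fbar] is the image of an edge of [F0] inside [S], and [h] maps [S] into [S']. *)
have barF' x : Fbar x \subset F' x.
  apply/fintype.subsetP=> y /imsetP[z /bigcupP[w] /[!inE] /andP[wS /eqP <-]].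
  case/andP=> zw zS ->.
  rewrite (fintype.subsetP (hmorph w)) ?(fintype.subsetP hS) //; exact: imset_f.
split=> d P i j A B d1 [[trF d0 _ _] cycP] AP BP.
- move=> hAB co_ij.
  have AS := cyclic_partition_sub cycP AP.
  have BS := cyclic_partition_sub cycP BP.
  have [M retM] := cyclic_partition_return cycP i.
  (* The path goes from [B] to [A]; its image closes up because [h A = h B]. *)
  have [N pathN] := cyclic_partition_path cycP BP AP.
  (* Surjectivity lifts both endpoints to [S], where a connecting path exists, and [h] maps it
     back. *)
  have trFbar : mv_transitive Fbar S'.
    move=> _ _ /hsurj[x xS <-] /hsurj[y yS <-].
    have [n n0 yx] := trF x y xS yS; exists n => //.
    exact: (mv_iter_morph FS hF xS yx).
  have lt_j : j < i + d by rewrite (leq_trans (ltn_ord j)) ?leq_addl.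
  apply: (@mv_mixing_coprime _ _ _ d (N * d + (i + d - j)) M (h A)) => //.
  + by apply: (fintype.subsetP hS); apply: imset_f.
  + by rewrite addn_gt0 subn_gt0 lt_j orbT.
  + by rewrite /coprime gcdnC gcdnMDl gcdnC -[_ - _]addn0
      -[_ == 1]coprimez_ord_sub addr0.
  + by move=> m leMm; apply: (mv_iter_morph FS hF AS); apply: retM.
  (* Only the starting point becomes [h B]; the end stays [h A]. *)
  + rewrite [X in mv_iter _ _ X]hAB.
    by apply: (mv_iter_morph FS hF BS); apply: pathN.
- move=> BA _ co_ij.
  have [M retM] := cyclic_partition_return cycP i.
  have [N pathN] := cyclic_partition_path cycP BP AP.
  (* The closed orbit at [A] is the added edge to [B], which accounts for the 1, followed by a path
     of [Fbar] back to [A]. *)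
  apply: (@mv_mixing_coprime _ _ _ d (N * d + (i + d - j + 1)) M A) => //.
  + move=> x y xS yS; have [n n0 yx] := trF x y xS yS; exists n => //.
    exact: mv_iter_mono barF' yx.
  + exact: cyclic_partition_sub cycP _ _ AP.
  + by rewrite !addn1 addnS.
  + by rewrite /coprime gcdnC gcdnMDl gcdnC -[_ == 1]coprimez_ord_sub.
  + by move=> m leMm; apply: (mv_iter_mono barF'); apply: retM.
  + rewrite addnA addnC; apply: mv_iterD (mv_iter1 BA) _.
    by apply: (mv_iter_mono barF'); apply: pathN.
Qed.
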